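(* Let $\{X_\alpha:\alpha\in\Lambda\}$ be an indexed family of nonempty topological spaces, for each $\alpha\in\Lambda$ let $\mathcal{P}_\alpha$ be an ideal of closed sets in $X_\alpha$, let $X=\prod_{\alpha\in\Lambda}X_\alpha$ and let $\mathcal{P}=\prod_{\alpha\in\Lambda}\mathcal{P}_\alpha$ be the product ideal. Then $X$ is locally-$\mathcal{P}$ if and only if both of the following hold: (1) $X_\alpha$ is locally-$\mathcal{P}_\alpha$ for each $\alpha\in\Lambda$; (2) $X_\alpha\in\mathcal{P}_\alpha$ for all but possibly finitely many $\alpha\in\Lambda$.
   Context: An ideal of closed sets in a space $Y$ is a family $\mathcal{Q}$ of closed subsets of $Y$ such that (1) $A,B\in\mathcal{Q}$ implies $A\cup B\in\mathcal{Q}$, and (2) $A\in\mathcal{Q}$, $B\subseteq A$ with $B$ closed in $Y$ implies $B\in\mathcal{Q}$. The product ideal $\prod_{\alpha\in\Lambda}\mathcal{P}_\alpha$ is the smallest ideal of closed sets in $\prod_{\alpha\in\Lambda}X_\alpha$ containing all sets of the form $\prod_{\alpha\in\Lambda}A_\alpha$ with $A_\alpha\in\mathcal{P}_\alpha$ for each $\alpha\in\Lambda$. For an ideal $\mathcal{Q}$ of closed sets in $Y$, the space $Y$ is locally-$\mathcal{Q}$ if each point of $Y$ has an open neighbourhood whose closure in $Y$ belongs to $\mathcal{Q}$. *)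

(* Defs.v *)
From mathcomp Require Import all_boot all_classical.
From mathcomp Require Import topology.

Set Implicit Arguments.
Unset Strict Implicit.
Unset Printing Implicit Defensive.

Local Open Scope classical_set_scope.

(* No nonemptiness is required: [set0] is an ideal of closed sets. *)
Record closed_ideal (Y : topologicalType) (Q : set (set Y)) : Prop := {
  closed_ideal_closed : Q `<=` closed;
  closed_idealU : forall A B, Q A -> Q B -> Q (A `|` B);
  closed_ideal_sub : forall A B, Q A -> B `<=` A -> closed B -> Q B
}.

Definition prod_boxes (L : Type) (X : L -> topologicalType)
    (P : forall a, set (set (X a))) : set (set (prod_topology X)) :=
  [set B | exists2 A : forall a, set (X a),
     forall a, P a (A a) & B = [set x | forall a, A a (x a)]].

Definition prod_ideal (L : Type) (X : L -> topologicalType)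
    (P : forall a, set (set (X a))) : set (set (prod_topology X)) :=
  smallest (@closed_ideal (prod_topology X)) (prod_boxes P).

Definition locally_ideal (Y : topologicalType) (Q : set (set Y)) : Prop :=
  forall y : Y, exists2 U : set Y, open_nbhs y U & Q (closure U).

(* Main.v *)
Require Import Defs.
From mathcomp Require Import all_boot all_classical.
From mathcomp Require Import finmap topology.

Local Open Scope classical_set_scope.

(** Forward: the closed sets all of whose projections are covered by members
    of the [P a] form an ideal containing the boxes, hence containing
    the product ideal; projections are open, and all but finitely many
    projections of a nonempty open set are onto.  Backward: a product of open
    neighbourhoods that are the whole factor at almost every index is open, and
    its closure lies in the closed box of the closures. *)

(** The sets containing every point that agrees with [y] on some finite set of indices form a filter
    [G]. The product topology is a supremum of initial topologies, so [G --> y] can be checked one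
    coordinate at a time, where a single index suffices. *)
Lemma nbhs_prod_finite (L : Type) (X : L -> topologicalType)
    (y : prod_topology X) (U : set (prod_topology X)) :
  nbhs y U ->
  exists2 F : set L, finite_set F &
    forall x : prod_topology X, (forall a, F a -> x a = y a) -> U x.
Proof.
pose G : set_system (prod_topology X) := [set V | exists2 F : set L,
  finite_set F & forall x, (forall a, F a -> x a = y a) -> V x].
have GF : Filter G.
  split.
  - by exists set0.
  - move=> A B [F finF FA] [F' finF' FB]; exists (F `|` F').
      by rewrite finite_setU.
    move=> x xy; split.
      by apply: FA => a Fa; apply: xy; left.
    by apply: FB => a Fa; apply: xy; right.
  - by move=> A B AB [F finF FA]; exists F => // x /FA /AB.
suff : G --> y by apply.
apply/cvg_sup => a V.
rewrite (@nbhsE (initial_topology (fun x : prod_topology X => x a))).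
move=> -[_ [[O oO <-] Oy] OV].
by exists [set a] => // x xy; apply: OV => /=; rewrite xy.
Qed.

Lemma proj_prod_continuous (L : Type) (X : L -> topologicalType) (a : L) :
  continuous (fun x : prod_topology X => x a).
Proof. exact: (@proj_continuous {classic L} X a). Qed.

Lemma proj_prod_open (L : Type) (X : L -> topologicalType) (a : L)
    (U : set (prod_topology X)) :
  open U -> open [set x a | x in (U : set (prod_topology X))].
Proof. exact: (@proj_open {classic L} X a). Qed.

(** Used to lift a point of one factor to the product; [{classic L}] supplies the equality test on
    indices. *)
Lemma prod_update (L : Type) (X : L -> Type) (y : forall a, X a) (a : L)
    (t : X a) :
  exists2 z : forall b, X b, z a = t & forall b, b <> a -> z b = y b.
Proof.
exists (@dfwith {classic L} X y a t); first exact: (@dfwithin {classic L}).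
move=> b ba; apply: (@dfwithout {classic L}).
by rewrite eq_sym; apply/(@eqP {classic L}).
Qed.

Lemma closed_box (L : Type) (X : L -> topologicalType)
    (A : forall a, set (X a)) :
  (forall a, closed (A a)) ->
  closed [set x : prod_topology X | forall a, A a (x a)].
Proof.
move=> cA x clx a; apply: cA => V /(proj_prod_continuous _ X a x) /clx.
by move=> [z [Az Vz]]; exists (z a).
Qed.

(** Only finitely many coordinates impose a condition, so the box contains a finite intersection of
    preimages under projections. *)
Lemma open_box (L : Type) (X : L -> topologicalType)
    (U : forall a, set (X a)) :
  (forall a, open (U a)) -> finite_set [set a | U a <> setT] ->
  open [set x : prod_topology X | forall a, U a (x a)].
Proof.
move=> oU /(@finite_fsetP {classic L})[F FE].
rewrite openE => x Ux; rewrite /interior.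
have : nbhs x (\bigcap_(a in [set` F]) [set z : prod_topology X | U a (z a)]).
  apply: filter_bigI => a _; apply: (proj_prod_continuous _ X a x).
  by apply: open_nbhs_nbhs; split.
apply: filterS => z zU a; have [->//|Ua] := pselect (U a = setT).
by apply: zU; rewrite -FE.
Qed.

(** A cover [B] is asked for because the projection of a closed set need not be closed, hence need
    not lie in [P a]. *)
Lemma prod_ideal_proj (L : Type) (X : L -> topologicalType)
    (P : forall a, set (set (X a))) (C : set (prod_topology X)) (a : L) :
  (forall a, closed_ideal (P a)) -> prod_ideal P C ->
  exists2 B, P a B & forall x : prod_topology X, C x -> B (x a).
Proof.
move=> idP PC.
pose Q : set (set (prod_topology X)) := [set C | closed C /\
  forall a, exists2 B, P a B & forall x : prod_topology X, C x -> B (x a)].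
suff [_ /(_ a)] : Q C by [].
apply: PC; split.
- split; first by move=> A [].
  + move=> A B [cA QA] [cB QB]; split; first exact: closedU.
    move=> b; have [A' PA' AA'] := QA b; have [B' PB' BB'] := QB b.
    exists (A' `|` B'); first exact: closed_idealU.
    by move=> x [/AA'|/BB']; [left|right].
  + move=> A B [cA QA] BA cB; split=> // b.
    by have [A' PA' AA'] := QA b; exists A' => // x /BA /AA'.
- move=> _ [A PA ->]; split; last by move=> b; exists (A b).
  by apply: closed_box => b; apply: closed_ideal_closed (PA b).
Qed.

Lemma prod_ideal_box (L : Type) (X : L -> topologicalType)
    (P : forall a, set (set (X a))) (A : forall a, set (X a))
    (C : set (prod_topology X)) :
  (forall a, P a (A a)) -> closed C ->
  C `<=` [set x : prod_topology X | forall a, A a (x a)] ->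
  prod_ideal P C.
Proof.
move=> PA cC CA Q [idQ boxQ].
by apply: (closed_ideal_sub idQ (boxQ _ _) CA cC); exists A.
Qed.

Theorem theorem3p2 (L : Type) (X : L -> topologicalType)
    (X_nonempty : forall a, [set: X a] !=set0)
    (P : forall a, set (set (X a)))
    (P_ideal : forall a, closed_ideal (P a)) :
  locally_ideal (prod_ideal P) <->
  (forall a, locally_ideal (P a)) /\
  finite_set [set a | ~ P a [set: X a]].
Proof.
have [y _] : exists y : prod_topology X, True.
  by exists (fun a => sval (cid (X_nonempty a))).
split=> [locP|[locP finP]].
  split=> [a t|].
    have [z za _] := prod_update _ X y a t.
    have [U [oU Uz] /(prod_ideal_proj _ _ _ _ a P_ideal)[B PB UB]] := locP z.
    exists [set x a | x in (U : set (prod_topology X))].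
      by split; [exact: proj_prod_open|exists z].
    (* [B] is closed and contains the projection of [U], hence also the closure of that
       projection. *)
    apply: (closed_ideal_sub (P_ideal a) PB); last exact: closed_closure.
    rewrite [B](iffLR (closure_id _)); last exact: closed_ideal_closed PB.
    by apply: closureS => _ [x Ux <-]; apply/UB/subset_closure.
  have [U nU PU] := locP y.
  have [F finF FU] := nbhs_prod_finite _ _ _ _ (open_nbhs_nbhs nU).
  apply: sub_finite_set finF => a /= nPa; apply: contrapT => nFa; apply: nPa.
  have [B PB UB] := prod_ideal_proj _ _ _ _ a P_ideal PU.
  (* As [a] is outside [F], changing [y] at [a] alone stays in [U], so [B] contains every [t]. *)
  suff <- : B = setT by [].
  rewrite -subTset => t _; have [z <- zy] := prod_update _ X y a t.
  apply/UB/subset_closure/FU => b Fb.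
  by apply: zy => ba; apply: nFa; rewrite -ba.
move=> x.
(* The third clause confines the indices with [U a <> setT] to the finite exceptional set. *)
have nbU : forall a, exists U : set (X a),
    [/\ open_nbhs (x a) U, P a (closure U) & P a setT -> U = setT].
  move=> a; have [PT|nPT] := pselect (P a setT).
    exists setT; split=> //; last by rewrite closureT.
    by split=> //; exact: openT.
  by have [U xU PU] := locP a (x a); exists U; split.
have [U UP] := all_sig (fun a => cid (nbU a)).
exists [set z : prod_topology X | forall a, U a (z a)].
  split; last by move=> a; have [[]] := UP a.
  apply: open_box => [a|]; first by have [[]] := UP a.
  apply: sub_finite_set finP => a /= UT PT.
  by apply: UT; have [_ _] := UP a; exact.
apply: (prod_ideal_box _ _ _ (fun a => closure (U a))).
- by move=> a; have [] := UP a.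
- exact: closed_closure.
- have /closure_id clB : closed [set z : prod_topology X |
      forall a, closure (U a) (z a)].
    apply: (closed_box _ X (fun a => closure (U a))) => a.
    exact: closed_closure.
  rewrite [X in _ `<=` X]clB; apply: closureS => z Uz a.
  exact/subset_closure/Uz.
Qed.
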